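(* Let $\Sigma$ be a compact oriented hyperbolic surface, possibly with boundary components $\zeta_1,\dots,\zeta_b$, and let $\xi$ be an essential simple closed curve that separates $\Sigma$ into two hyperbolic subsurfaces $\Sigma_1$ and $\Sigma_2$. Let $\Gamma=\pi_1(\Sigma)$ and $\mathcal S=\{\langle\xi\rangle,\langle\zeta_1\rangle,\dots,\langle\zeta_b\rangle\}$. Choose a boundary frame $\mathscr B$ and a $\{\xi\}$-frame $\mathscr C$. Let $[\rho]\in\overline{\mathcal X}_n^{\mathscr B}(\Gamma,\mathscr C)$ be such that $[\rho_{\Gamma_{\Sigma_i}}]\in\overline{\mathcal X}_n^{\mathscr B_i}(\Gamma_{\Sigma_i})$ for $i=1,2$, where $$\mathscr B_i=\{(\zeta,B)\mid\zeta\text{ is a component of }\partial\overline{\Sigma_i}\text{ and }(\iota_{\Sigma_i}(\zeta),B)\in\mathscr B\cup\mathscr C\}.$$ Fix a representation $\rho$ in the class $[\rho]$. Then for all $[\alpha],[\beta]\in H^1_{\mathrm{par}}(\Gamma,\mathcal S;\mathfrak g_\rho)$, $$\omega_K^\Sigma([\alpha],[\beta])=\omega_K^{\Sigma_1}(\iota_{\Sigma_1}^*[\alpha],\iota_{\Sigma_1}^*[\beta])+\omega_K^{\Sigma_2}(\iota_{\Sigma_2}^*[\alpha],\iota_{\Sigma_2}^*[\beta]).$$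
   Context: $G=\mathrm{PSL}_n(\mathbb R)$, $\mathfrak g=\mathfrak{sl}_n(\mathbb R)$. A compact oriented hyperbolic surface is a compact connected oriented surface of negative Euler characteristic; essential means not homotopic to a point or a boundary component. $\overline{\Sigma_i}$ is the completion of $\Sigma_i$ and $\iota_{\Sigma_i}:\overline{\Sigma_i}\to\Sigma$ extends the inclusion. $\Gamma_{\Sigma_1},\Gamma_{\Sigma_2}\subset\Gamma$ are the vertex groups ($\cong\pi_1(\Sigma_i)$) in the splitting $\Gamma=\Gamma_{\Sigma_1}*_{\langle\xi\rangle}\Gamma_{\Sigma_2}$, and $\rho_{\Gamma_{\Sigma_i}}$ is the restriction of $\rho$. $\overline{\mathcal X}_n(\Gamma)=\{\rho\in\mathrm{Hom}(\Gamma,G):\rho\text{ irreducible},\ Z_G(\rho)=\{1\}\}/G$, $Z_G(\rho)$ being the centralizer of the image. A boundary frame assigns a conjugacy class $B_i$ of $G$ to each $\zeta_i$; a $\{\xi\}$-frame is $\{(\xi,C)\}$ with $C$ a conjugacy class of $G$. $\overline{\mathcal X}_n^{\mathscr B}(\Gamma)$ is the set of $[\rho]\in\overline{\mathcal X}_n(\Gamma)$ with $\rho(\zeta_i)\in B_i$ for all $i$, and $\overline{\mathcal X}_n^{\mathscr B}(\Gamma,\mathscr C)$ is the subset with $\rho(\xi)\in C$. $\mathfrak g_\rho$ is $\mathfrak g$ with $\gamma\cdot X=\mathrm{Ad}_{\rho(\gamma)}X$. Cocycles: maps $\alpha:\Gamma\to\mathfrak g$ with $\alpha(xy)=\alpha(x)+x\cdot\alpha(y)$;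 coboundaries: $d_\Gamma X(\gamma)=\gamma\cdot X-X$. For a finite family $\mathcal S$ of subgroups (given up to conjugacy), $Z^1_{\mathrm{par}}(\Gamma,\mathcal S;\mathfrak g_\rho)$ is the space of cocycles restricting to a coboundary on each member of $\mathcal S$, and $H^1_{\mathrm{par}}=Z^1_{\mathrm{par}}/B^1$. Restriction of cocycles induces $\iota_{\Sigma_i}^*:H^1_{\mathrm{par}}(\Gamma,\mathcal S;\mathfrak g_\rho)\to H^1_{\mathrm{par}}(\Gamma_{\Sigma_i},\mathcal S_i;\mathfrak g_{\rho_{\Gamma_{\Sigma_i}}})$, where $\mathcal S_i=\{\langle\zeta\rangle\subset\Gamma_{\Sigma_i}:\zeta\text{ a component of }\partial\overline{\Sigma_i}\}$. The pairing $\omega_K^\Sigma$: fix a presentation, compatible with the orientation, $\Gamma=\langle x_1,y_1,\dots,x_g,y_g,z_1,\dots,z_b\mid R\rangle$, $R=\prod_i[x_i,y_i]\prod_jz_j$, with $z_j$ representing $\zeta_j$ (same convention for the $\Sigma_i$ with induced orientation). With Fox derivatives, cocycles extended linearly to $\mathbb R\Gamma$, and $\overline{(\cdot)}$ induced by inversion, $\langle\alpha\smile\beta,[\Sigma]\rangle=-\sum_s\mathrm{Tr}\,\alpha(\overline{\partial R/\partial s})\beta(s)$, the sum over all generators $s$. For $[\alpha],[\beta]\in H^1_{\mathrm{par}}(\Gamma,\{\langle\zeta_j\rangle\};\mathfrak g_\rho)$, which contains $H^1_{\mathrm{par}}(\Gamma,\mathcal S;\mathfrak g_\rho)$, $\omega_K^\Sigma([\alpha],[\beta])=\langle\alpha\smile\beta,[\Sigma]\rangle-\sum_{j=1}^b\mathrm{Tr}\,X_j\beta(z_j)$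 with $X_j\in\mathfrak g$ such that $\alpha(z_j)=z_j\cdot X_j-X_j$. This is well defined. *)

(* Defs.v *)
From HB Require Import structures.
From mathcomp Require Import all_boot all_order all_algebra.
From mathcomp Require Import boolp classical_sets functions reals.
From mathcomp.multinomials Require Import freeg.

Set Implicit Arguments.
Unset Strict Implicit.
Unset Printing Implicit Defensive.

Import GRing.Theory.
Local Open Scope classical_set_scope.
Local Open Scope quotient_scope.
Local Open Scope ring_scope.

Section PSL.
Variables (R : realType) (n : nat).

Record SL := MkSL { slmx :> 'M[R]_n; _ : \det slmx == 1 }.
HB.instance Definition _ := [isSub for slmx].
HB.instance Definition _ := [Choice of SL by <:].

Lemma SL_det (A : SL) : \det A = 1. Proof. by case: A => A /= /eqP. Qed.

Lemma SL_unit (A : SL) : (A : 'M_n) \in unitmx.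
Proof. by rewrite unitmxE SL_det unitr1. Qed.

Fact SL_one_subproof : \det (1%:M : 'M[R]_n) == 1. Proof. by rewrite det1. Qed.
Fact SL_mul_subproof (A B : SL) : \det (A *m B) == 1.
Proof. by rewrite det_mulmx !SL_det mulr1. Qed.
Fact SL_inv_subproof (A : SL) : \det (invmx A) == 1.
Proof. by rewrite det_inv SL_det invr1. Qed.

Definition SL_one := MkSL SL_one_subproof.
Definition SL_mul A B := MkSL (SL_mul_subproof A B).
Definition SL_inv A := MkSL (SL_inv_subproof A).

Fact SL_mulA : associative SL_mul.
Proof. by move=> A B C; apply: val_inj; rewrite /= mulmxA. Qed.
Fact SL_mul1 : left_id SL_one SL_mul.
Proof. by move=> A; apply: val_inj; rewrite /= mul1mx. Qed.
Fact SL_1mul : right_id SL_one SL_mul.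
Proof. by move=> A; apply: val_inj; rewrite /= mulmx1. Qed.
Fact SL_mulV : left_inverse SL_one SL_inv SL_mul.
Proof. by move=> A; apply: val_inj; rewrite /= mulVmx ?SL_unit. Qed.
Fact SL_Vmul : right_inverse SL_one SL_inv SL_mul.
Proof. by move=> A; apply: val_inj; rewrite /= mulmxV ?SL_unit. Qed.

HB.instance Definition _ :=
  isGroup.Build SL SL_mulA SL_mul1 SL_1mul SL_mulV SL_Vmul.

(* The centre of SL_n(R) consists of its scalar matrices. *)
Definition PSL_rel (A B : SL) : bool := is_scalar_mx (A *m invmx B).

Lemma PSL_relP (A B : SL) : reflect (exists a : R, slmx A = a *: slmx B) (PSL_rel A B).
Proof.
apply: (iffP is_scalar_mxP) => -[a e]; exists a.
  by rewrite -mul_scalar_mx -e mulmxKV ?SL_unit.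
by rewrite e -scalemxAl mulmxV ?SL_unit // scalemx1.
Qed.

Fact PSL_rel_refl : reflexive PSL_rel.
Proof. by move=> A; apply/PSL_relP; exists 1; rewrite scale1r. Qed.
Fact PSL_rel_sym : symmetric PSL_rel.
Proof.
suff h A B : PSL_rel A B -> PSL_rel B A by move=> A B; apply/idP/idP; apply: h.
move=> /PSL_relP[a e]; apply/PSL_relP; exists a^-1.
have [a0|a0] := eqVneq a 0; last by rewrite e scalerA mulVf ?scale1r.
have A0 : A = 0 :> 'M_n by rewrite e a0 scale0r.
have I0 : 1%:M = 0 :> 'M[R]_n by rewrite -(mulmxV (SL_unit A)) A0 mul0mx.
by rewrite -[LHS]mulmx1 -[X in _ = _ *: X]mulmx1 I0 !mulmx0 scaler0.
Qed.
Fact PSL_rel_trans : transitive PSL_rel.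
Proof.
move=> B A C /PSL_relP[a e] /PSL_relP[c f]; apply/PSL_relP; exists (a * c).
by rewrite e f scalerA.
Qed.

Canonical PSL_equiv := EquivRel PSL_rel PSL_rel_refl PSL_rel_sym PSL_rel_trans.
Definition PSL := {eq_quot PSL_rel}.
HB.instance Definition _ := Choice.on PSL.
HB.instance Definition _ := EqQuotient.on PSL.

Lemma PSL_eqP (A B : SL) :
  \pi_PSL A = \pi_PSL B <-> exists a : R, slmx A = a *: slmx B.
Proof. by split=> [/eqmodP /PSL_relP|/PSL_relP /eqmodP]. Qed.

Lemma PSL_repr (A : SL) : exists a : R, slmx (repr (\pi_PSL A)) = a *: slmx A.
Proof. by apply/PSL_eqP; rewrite reprK. Qed.

Definition PSL_one : PSL := \pi_PSL (1%g : SL).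
Definition PSL_mul (p q : PSL) : PSL := \pi_PSL (repr p * repr q)%g.
Definition PSL_inv (p : PSL) : PSL := \pi_PSL (repr p)^-1%g.

Lemma PSL_mulE (A B : SL) : PSL_mul (\pi_PSL A) (\pi_PSL B) = \pi_PSL (A * B)%g.
Proof.
apply/PSL_eqP => /=; have [a ->] := PSL_repr A; have [c ->] := PSL_repr B.
by exists (a * c); rewrite -scalemxAl -scalemxAr scalerA.
Qed.
Fact PSL_mulA : associative PSL_mul.
Proof.
elim/quotW=> A; elim/quotW=> B; elim/quotW=> C.
rewrite (PSL_mulE B C) (PSL_mulE A B) (PSL_mulE A (B * C)%g).
by rewrite (PSL_mulE (A * B)%g C) mulgA.
Qed.
Fact PSL_mul1 : left_id PSL_one PSL_mul.
Proof. by elim/quotW=> A; rewrite PSL_mulE mul1g. Qed.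
Fact PSL_1mul : right_id PSL_one PSL_mul.
Proof. by elim/quotW=> A; rewrite PSL_mulE mulg1. Qed.
Fact PSL_mulV : left_inverse PSL_one PSL_inv PSL_mul.
Proof. by move=> p; rewrite -{2}[p]reprK PSL_mulE mulVg. Qed.
Fact PSL_Vmul : right_inverse PSL_one PSL_inv PSL_mul.
Proof. by move=> p; rewrite -{1}[p]reprK PSL_mulE mulgV. Qed.

HB.instance Definition _ :=
  isGroup.Build PSL PSL_mulA PSL_mul1 PSL_1mul PSL_mulV PSL_Vmul.

Definition traceless : pred 'M[R]_n := fun X => \tr X == 0.

Fact traceless_submod_closed : submod_closed traceless.
Proof.
split; first by rewrite /traceless unfold_in mxtrace0.
move=> a X Y; rewrite !unfold_in /traceless => /eqP hX /eqP hY.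
by rewrite mxtraceD mxtraceZ hX hY mulr0 addr0.
Qed.
HB.instance Definition _ :=
  GRing.isSubmodClosed.Build R 'M[R]_n traceless traceless_submod_closed.

Record sl := MkSl { liemx :> 'M[R]_n; _ : liemx \in traceless }.
HB.instance Definition _ := [isSub for liemx].
HB.instance Definition _ := [Choice of sl by <:].
HB.instance Definition _ := [SubChoice_isSubLmodule of sl by <:].

Fact Ad_subproof (A : SL) (X : sl) : (A *m X *m invmx A) \in traceless.
Proof.
rewrite unfold_in /traceless mxtrace_mulC mulmxA mulVmx ?SL_unit // mul1mx.
by case: X.
Qed.

(* The value does not depend on the lift [repr p] of [p] to SL_n(R). *)
Definition Ad (p : PSL) (X : sl) : sl := MkSl (Ad_subproof (repr p) X).

Lemma Ad_pi (A : SL) (X : sl) : Ad (\pi_PSL A) X = A *m X *m invmx A :> 'M_n.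
Proof.
rewrite /=; have [a e] := PSL_repr A.
have h : a *: invmx (repr (\pi_PSL A)) = invmx A.
  rewrite -[LHS](mulmxK (SL_unit A)) -scalemxAl scalemxAr -e.
  by rewrite mulVmx ?SL_unit // mul1mx.
by rewrite -h -scalemxAr !scalemxAl -e.
Qed.

Lemma Ad1 (X : sl) : Ad 1%g X = X.
Proof.
apply: val_inj; change (liemx (Ad (\pi_PSL (1%g : SL)) X) = X).
by rewrite Ad_pi invmx1 mul1mx mulmx1.
Qed.

Lemma AdM (p q : PSL) (X : sl) : Ad (p * q)%g X = Ad p (Ad q X).
Proof.
apply: val_inj.
change (liemx (Ad (\pi_PSL (repr p * repr q)%g) X) = liemx (Ad p (Ad q X))).
rewrite Ad_pi /=.
have -> : invmx (repr p *m repr q) = invmx (repr q) *m invmx (repr p).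
  exact: (congr1 slmx (invgM (repr p) (repr q))).
by rewrite !mulmxA.
Qed.

Fact Ad_is_linear (p : PSL) : linear (Ad p).
Proof.
move=> a X Y; apply: val_inj => /=.
by rewrite mulmxDr mulmxDl -scalemxAr -scalemxAl.
Qed.
HB.instance Definition _ (p : PSL) :=
  GRing.isLinear.Build R sl sl _ (Ad p) (Ad_is_linear p).

End PSL.

(* Generators x_i, y_i (i < g) and z_j (j < b). *)
Definition gen (g b : nat) : Type := ('I_g + 'I_g + 'I_b)%type.
HB.instance Definition _ g b := Finite.on (gen g b).

Definition genx g b (i : 'I_g) : gen g b := inl (inl i).
Definition geny g b (i : 'I_g) : gen g b := inl (inr i).
Definition genz g b (j : 'I_b) : gen g b := inr j.

(* Words in the generators: [(s, false)] is the letter s, [(s, true)] is s^-1. *)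
Definition word (g b : nat) := seq (gen g b * bool).

(* R = [x_1, y_1] ... [x_g, y_g] z_1 ... z_b with [x, y] = x y x^-1 y^-1. *)
Definition relator (g b : nat) : word g b :=
  flatten [seq [:: (genx b i, false); (geny b i, false);
                   (genx b i, true); (geny b i, true)] | i <- enum 'I_g]
  ++ [seq (genz g j, false) | j <- enum 'I_b].

Definition letter (G : groupType) g b (P : gen g b -> G) (l : gen g b * bool) : G :=
  (if l.2 then (P l.1)^-1 else P l.1)%g.

Definition eval (G : groupType) g b (P : gen g b -> G) (w : word g b) : G :=
  (\prod_(l <- w) letter P l)%g.

(* [G = < x_i, y_i, z_j | R >], as the universal property of a presentation. *)
Definition presents (G : groupType) g b (P : gen g b -> G) : Prop :=
  eval P (relator g b) = 1%g /\
  forall (H : groupType) (Q : gen g b -> H), eval Q (relator g b) = 1%g ->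
    exists f : {multiplicative G -> H}, (forall s, f (P s) = Q s) /\
      forall f' : {multiplicative G -> H}, (forall s, f' (P s) = Q s) -> f' =1 f.

(* A compact connected oriented surface of negative Euler characteristic
   2 - 2 genus - nbd, given by its fundamental group with a standard
   presentation compatible with the orientation; [bd j] represents the j-th
   boundary component with its boundary orientation. *)
Record surface (G : groupType) := Surface {
  genus : nat;
  nbd : nat;
  gens : gen genus nbd -> G;
  gens_presents : presents gens;
  surface_hyperbolic : (2 < genus.*2 + nbd)%N
}.

Definition bd (G : groupType) (S : surface G) (j : 'I_(nbd S)) : G :=
  gens (genz (genus S) j).

Definition conj_to (G : groupType) (x y : G) : Prop :=
  exists u : G, y = (u * x * u^-1)%g.

Definition cyc (G : groupType) (x : G) : set G :=
  [set y | exists m : nat, y = (x ^+ m)%g \/ y = (x ^- m)%g].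

(* The family of the cyclic subgroups generated by the boundary components,
   together with, for the second one, a curve [xi]. *)
Definition bd_family (G : groupType) (S : surface G) : set (set G) :=
  [set cyc (bd j) | j in [set: 'I_(nbd S)]].
Definition bd_xi_family (G : groupType) (S : surface G) (xi : G) : set (set G) :=
  cyc xi |` bd_family S.

(* [xi] with the orientation selected by [e]. *)
Definition orient (G : groupType) (xi : G) (e : bool) : G :=
  (if e then xi^-1 else xi)%g.

(* [G] is the amalgamated product of [G1] and [G2] along [c1 = c2]. *)
Definition amalgam (G G1 G2 : groupType) (i1 : G1 -> G) (i2 : G2 -> G)
    (c1 : G1) (c2 : G2) : Prop :=
  i1 c1 = i2 c2 /\
  forall (H : groupType) (f1 : {multiplicative G1 -> H})
         (f2 : {multiplicative G2 -> H}), f1 c1 = f2 c2 ->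
    exists f : {multiplicative G -> H},
      [/\ f \o i1 =1 f1, f \o i2 =1 f2 &
          forall f' : {multiplicative G -> H},
            f' \o i1 =1 f1 -> f' \o i2 =1 f2 -> f' =1 f].

(* The value on the fundamental class of the cup product of the classes in
   H^1(S, bd S; Z) defined by two homomorphisms to Z killing the boundary. *)
Definition intersection (G : groupType) (S : surface G) (f h : G -> int) : int :=
  \sum_(i < genus S) (f (gens (genx _ i)) * h (gens (geny _ i))
                      - f (gens (geny _ i)) * h (gens (genx _ i))).

Definition hom_int (G : groupType) (f : G -> int) : Prop :=
  forall x y : G, f (x * y)%g = f x + f y.

(* [S'], with fundamental group [G'], is a subsurface of [S] cut off by [xi],
   the rest of [S] having fundamental group [G'']. The map [t] describes how the
   boundary components of (the completion of) [S'] map to [S]: [Some j] stands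
   for the j-th boundary component of [S] and [None] for [xi]. The orientation
   of [S'] is the one induced from [S]: boundary components of [S] keep their
   orientation, and integral classes supported in [S'] have the same products
   on [S'] and on [S] (the latter is what sees the orientation of a closed [S]). *)
Record subsurface (G G' G'' : groupType) (S : surface G) (S' : surface G')
    (i' : G' -> G) (i'' : G'' -> G) (xi' : G) (t : 'I_(nbd S') -> option 'I_(nbd S))
    : Prop := {
  sub_inj : injective i';
  sub_bd : forall k j, t k = Some j -> conj_to (bd j) (i' (bd k));
  sub_xi : forall k, t k = None -> exists u : G', xi' = i' (u * bd k * u^-1)%g;
  sub_bd_inj : injective t;
  sub_xi_bd : exists k, t k = None;
  sub_orientation : forall f h : G -> int, hom_int f -> hom_int h ->
    (forall x, f (i'' x) = 0) -> (forall x, h (i'' x) = 0) ->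
    (forall j : 'I_(nbd S), f (bd j) = 0) ->
    (forall j : 'I_(nbd S), h (bd j) = 0) ->
    intersection S f h = intersection S' (f \o i') (h \o i')
}.

(* The essential simple closed curve [xi] separates [S] into [S1] and [S2]:
   the van Kampen splitting together with the peripheral structures. As
   an oriented boundary component, it is [orient xi e] for [S1], hence
   [orient xi (~~ e)] for [S2]. *)
Record separates (G G1 G2 : groupType) (S : surface G) (S1 : surface G1)
    (S2 : surface G2) (i1 : G1 -> G) (i2 : G2 -> G) (xi : G) (e : bool)
    (t1 : 'I_(nbd S1) -> option 'I_(nbd S))
    (t2 : 'I_(nbd S2) -> option 'I_(nbd S)) : Prop := {
  sep_essential : xi <> 1%g /\
    forall j : 'I_(nbd S), ~ conj_to (bd j) xi /\ ~ conj_to (bd j) xi^-1%g;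
  sep_amalgam : exists c1 c2, i1 c1 = xi /\ amalgam i1 i2 c1 c2;
  sep_sub1 : subsurface i1 i2 (orient xi e) t1;
  sep_sub2 : subsurface i2 i1 (orient xi (~~ e)) t2;
  sep_bd : forall j, (exists k, t1 k = Some j) <-> ~ (exists k, t2 k = Some j)
}.

Section Characters.
Variables (R : realType) (n : nat).

Definition rep (G : groupType) := {multiplicative G -> PSL R n}.

(* A subspace of column vectors is encoded by a matrix whose rows are the
   transposes of a generating family, hence the transposed action. *)
Definition irreducible_rep (G : groupType) (rho : rep G) : Prop :=
  (0 < n)%N /\
  forall U : 'M[R]_n, (forall x, stablemx U (repr (rho x))^T) ->
    \rank U = 0%N \/ \rank U = n.

Definition trivial_centralizer (G : groupType) (rho : rep G) : Prop :=
  forall p : PSL R n, (forall x, p * rho x = rho x * p)%g -> p = 1%g.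

(* The class of [rho] modulo conjugation by PSL_n(R). *)
Definition rep_class (G : groupType) (rho : rep G) : set (rep G) :=
  [set sigma | exists p : PSL R n, forall x, sigma x = (p * rho x * p^-1)%g].

Definition Xbar (G : groupType) : set (set (rep G)) :=
  [set rep_class rho | rho in
     [set rho | irreducible_rep rho /\ trivial_centralizer rho]].

Definition conj_class (B : set (PSL R n)) : Prop :=
  exists p, B = [set q | conj_to p q].

Definition Xbar_bd (G : groupType) (S : surface G)
    (B : 'I_(nbd S) -> set (PSL R n)) : set (set (rep G)) :=
  [set c | Xbar c /\ forall rho, c rho -> forall j, B j (rho (bd j))].

Definition Xbar_bd_xi (G : groupType) (S : surface G)
    (B : 'I_(nbd S) -> set (PSL R n)) (xi : G) (C : set (PSL R n)) :
    set (set (rep G)) :=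
  [set c | Xbar_bd B c /\ forall rho, c rho -> C (rho xi)].

(* The boundary frame induced on a subsurface. The curve [xi] carries [C], so
   the reversed curve carries the class of inverses. *)
Definition induced_frame (b b' : nat) (B : 'I_b -> set (PSL R n))
    (C : set (PSL R n)) (e : bool) (t : 'I_b' -> option 'I_b) (k : 'I_b') :
    set (PSL R n) :=
  if t k is Some j then B j else [set p | C (orient p e)].

End Characters.

Section Cohomology.
Variables (R : realType) (n : nat).
Local Notation sl := (sl R n).

Section Group.
Variables (G : groupType) (rho : rep R n G).

Definition is_cocycle (a : G -> sl) : Prop :=
  forall x y, a (x * y)%g = a x + Ad (rho x) (a y).

Definition cobd (X : sl) (x : G) : sl := Ad (rho x) X - X.

Definition Z1 : Type := {a : G -> sl | `[< is_cocycle a >]}.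
HB.instance Definition _ := Choice.on Z1.

Definition cohomologous (a a' : Z1) : bool :=
  `[< exists X, forall x, val a x - val a' x = cobd X x >].

Fact cohomologous_refl : reflexive cohomologous.
Proof. by move=> a; apply/asboolP; exists 0 => x; rewrite /cobd raddf0 !subrr. Qed.
Fact cohomologous_sym : symmetric cohomologous.
Proof.
suff h a a' : cohomologous a a' -> cohomologous a' a.
  by move=> a a'; apply/idP/idP; apply: h.
move=> /asboolP[X hX]; apply/asboolP; exists (- X) => x.
by rewrite -opprB hX /cobd raddfN opprB opprK addrC.
Qed.
Fact cohomologous_trans : transitive cohomologous.
Proof.
move=> a' a a'' /asboolP[X hX] /asboolP[Y hY]; apply/asboolP; exists (X + Y) => x.
rewrite -[val a x](subrK (val a' x)) -addrA hX hY /cobd raddfD.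
by rewrite opprD addrACA.
Qed.
Canonical cohomologous_equiv :=
  EquivRel cohomologous cohomologous_refl cohomologous_sym cohomologous_trans.

Definition H1 := {eq_quot cohomologous}.
HB.instance Definition _ := Choice.on H1.
HB.instance Definition _ := EqQuotient.on H1.

Definition Z1par (F : set (set G)) : set Z1 :=
  [set a | forall K, F K -> exists X, forall x, K x -> val a x = cobd X x].

Definition H1par (F : set (set G)) : set H1 := [set \pi_H1 a | a in Z1par F].

End Group.

Section Restriction.
Variables (G G' : groupType) (rho : rep R n G) (i : {multiplicative G' -> G}).

Definition res_rep : rep R n G' := rho \o i.

Fact res_Z1_subproof (a : Z1 rho) : `[< is_cocycle res_rep (val a \o i) >].
Proof.
by case: a => a /= /asboolP ha; apply/asboolP => x y /=; rewrite gmulfM ha.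
Qed.
Definition res_Z1 (a : Z1 rho) : Z1 res_rep := Sub (val a \o i) (res_Z1_subproof a).

Definition res_H1 (a : H1 rho) : H1 res_rep := \pi_(H1 res_rep) (res_Z1 (repr a)).

End Restriction.

Section Pairing.
Variables (G : groupType).
Local Notation RG := {freeg G / R}.

Definition gr (x : G) : RG := [freeg [:: (1, x)]].
Definition gr_lmul (x : G) (D : RG) : RG := fglift (fun y => gr (x * y)%g) D.
Definition gr_bar (D : RG) : RG := fglift (fun y => gr y^-1%g) D.

(* The image in the group ring of [G] of the Fox derivative of [w] by [s]. *)
Fixpoint fox (g b : nat) (P : gen g b -> G) (s : gen g b) (w : word g b) : RG :=
  if w is l :: w' then
    (if l.1 == s then if l.2 then - gr (P s)^-1%g else gr 1%g else 0)
    + gr_lmul (letter P l) (fox P s w')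
  else 0.

Definition trform (X Y : sl) : R := \tr (liemx X *m liemx Y).

Variables (S : surface G) (rho : rep R n G).

Definition cup (a b : Z1 rho) : R :=
  - \sum_(s : gen (genus S) (nbd S))
      trform (fglift (val a) (gr_bar (fox (@gens _ S) s (relator _ _))))
             (val b (gens s)).

(* Some X with [a x = x . X - X]; meaningful if there is one. *)
Definition primitive (a : Z1 rho) (x : G) : sl :=
  xget 0 [set X | val a x = cobd rho X x].

Definition omega_Z1 (a b : Z1 rho) : R :=
  cup a b - \sum_(j < nbd S) trform (primitive a (bd j)) (val b (bd j)).

(* On H1par of the boundary subgroups, independent of all choices. *)
Definition omegaK (a b : H1 rho) : R := omega_Z1 (repr a) (repr b).

End Pairing.

End Cohomology.

Section RestrictionPar.
Variables (R : realType) (n : nat) (G : groupType) (rho : rep R n G).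

Lemma repr_H1par (F : set (set G)) (a : H1 rho) : H1par F a -> Z1par F (repr a).
Proof.
move=> [al hal <-] K FK; have [X hX] := hal K FK.
have /eqmodP/asboolP[Y hY] : repr (\pi_(H1 rho) al) = al %[mod H1 rho].
  by rewrite reprK.
exists (Y + X) => x Kx; rewrite -[LHS](subrK (val al x)) hY hX // /cobd raddfD.
by rewrite opprD addrACA.
Qed.

Lemma rep1 : rho 1%g = 1%g.
Proof. by apply: (mulgI (rho 1%g)); rewrite -gmulfM !mulg1. Qed.

Lemma cocycle1 (a : Z1 rho) : val a 1%g = 0.
Proof.
case: a => a /= /asboolP ha; have := ha 1%g 1%g.
by rewrite mulg1 rep1 Ad1 -[LHS]addr0 => /addrI.
Qed.

Lemma cocycle_conj (a : Z1 rho) (u y : G) (X : sl R n) :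
  val a y = cobd rho X y ->
  val a (u^-1 * y * u)%g =
  cobd rho (Ad (rho u^-1%g) (val a u + X)) (u^-1 * y * u)%g.
Proof.
move=> ay; have a1 := cocycle1 a; case: a ay a1 => a /= /asboolP ha ay a1.
have au : a u^-1%g = - Ad (rho u^-1%g) (a u).
  by apply/eqP; rewrite -addr_eq0 -ha mulVg a1.
rewrite !ha au ay /cobd -AdM -gmulfM -mulgA mulgV mulg1 !gmulfM !AdM.
rewrite !raddfB !raddfD /=.
rewrite addrC -[RHS]addrA; congr (_ + _); exact: addrCA.
Qed.

Lemma cyc_conj (G' : groupType) (i : {multiplicative G' -> G}) (e : bool)
    (c x : G') (z u : G) :
  i c = (u^-1 * orient z e * u)%g -> cyc c x ->
  exists2 y, cyc z y & i x = (u^-1 * y * u)%g.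
Proof.
have i1 : i 1%g = 1%g by apply: (mulgI (i 1%g)); rewrite -gmulfM !mulg1.
have iX m : i (c ^+ m)%g = (i c ^+ m)%g.
  by elim: m => [|m IHm]; rewrite ?expg0 // !expgS gmulfM IHm.
have iV w : i w^-1%g = (i w)^-1%g.
  by apply: (mulgI (i w)); rewrite -gmulfM !mulgV i1.
rewrite -mulgA -/(conjg _ u) => ic [m xE].
have cycX : cyc z (orient z e ^+ m)%g.
  by exists m; rewrite /orient; case: e {ic}; rewrite ?expVgn; [right|left].
have cycV y : cyc z y -> cyc z y^-1%g.
  by move=> [k [->|->]]; exists k; [right|left; rewrite invgK].
case: xE => ->.
  by exists (orient z e ^+ m)%g => //; rewrite iX ic -conjXg /conjg mulgA.
exists (orient z e ^- m)%g; first exact: cycV.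
by rewrite iV iX ic -conjXg -conjVg /conjg mulgA.
Qed.

Lemma res_H1par (G' G'' : groupType) (S : surface G) (S' : surface G')
    (i' : {multiplicative G' -> G}) (i'' : G'' -> G) (xi : G) (e : bool)
    (t : 'I_(nbd S') -> option 'I_(nbd S)) (a : H1 rho) :
  subsurface i' i'' (orient xi e) t ->
  H1par (bd_xi_family S xi) a -> H1par (bd_family S') (res_H1 i' a).
Proof.
move=> ht /repr_H1par ha; exists (res_Z1 i' (repr a)) => // _ [k _ <-].
have [z [e' [u [Fz ik]]]] : exists z e' u, bd_xi_family S xi (cyc z) /\
    i' (bd k) = (u^-1 * orient z e' * u)%g.
  case tk : (t k) => [j|].
    have [u ju] := sub_bd ht tk; exists (bd j), false, (u^-1)%g; split.
      by right; exists j.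
    by rewrite invgK ju.
  have [u uE] := sub_xi ht tk; exists xi, e, (i' u); split; first by left.
  by rewrite uE -mulgA -gmulfM mulgVK gmulfM mulKg.
have [X hX] := ha _ Fz.
exists (Ad (rho u^-1%g) (val (repr a) u + X)) => x /(cyc_conj ik)[y zy xE].
by rewrite /= /cobd /= xE; apply: cocycle_conj; apply: hX.
Qed.

End RestrictionPar.

(* Main.v *)
(* Give [G x R] the product twisted by the 2-cocycle [Tr (a x) (x . b y)]: the
   cup product evaluated on the fundamental class is then the value of the
   relator of [S] at the lifts [(s, 0)] of the generators. Shifting the
   boundary lifts so that they lie on the canonical splittings over the
   subgroups [<z_j>] turns this value into [omega].
   If a surface has boundary, the universal property of its presentation splits
   the extension, and comparing the splitting with the canonical ones gives
   [omega] as a sum of boundary terms depending only on the oriented conjugacy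
   classes of the boundary curves. If [S] has boundary, a splitting over [S]
   restricts to [S1] and [S2], and the two terms at [xi] cancel.
   If [S] is closed, choose integral classes [f], [h] supported in [S1] of
   intersection number 1, and let [lam] be the right-hand side of the theorem.
   Subtracting [lam] times the product of [f] and [h] makes splittings over [S1]
   and [S2] agree at [xi], hence glue to a splitting over [S], so [omega] is
   [lam] times the intersection number of [f] and [h] on [S]. *)
Require Import Defs.
From HB Require Import structures.
From mathcomp Require Import all_boot all_order all_algebra ring.
From mathcomp Require Import boolp classical_sets functions reals.
From mathcomp.multinomials Require Import freeg.

Set Implicit Arguments.
Unset Strict Implicit.
Unset Printing Implicit Defensive.

Import GRing.Theory.
Local Open Scope classical_set_scope.
Local Open Scope ring_scope.

(** * Two-cocycles and their trivializations *)

Section Trivialization.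
Variables (G : groupType) (A : zmodType).

Definition two_cocycle (c : G -> G -> A) : Prop :=
  [/\ forall x, c 1%g x = 0, forall x, c x 1%g = 0 &
      forall x y z, c x y + c (x * y)%g z = c y z + c x (y * z)%g].

(** The sign convention makes [x |-> (x, phi x)] a homomorphic section of the central extension
    defined by [c]; so [c] is minus the usual coboundary of [phi]. *)
Definition trivializes (c : G -> G -> A) (phi : G -> A) : Prop :=
  forall x y, phi (x * y)%g = phi x + phi y + c x y.

Lemma trivializes1 c phi : two_cocycle c -> trivializes c phi -> phi 1%g = 0.
Proof.
move=> [c1 _ _] h; have := h 1%g 1%g.
by rewrite mulg1 c1 addr0 -{1}[phi _]addr0 => /addrI.
Qed.

Lemma trivializesV c phi x : two_cocycle c -> trivializes c phi ->
  phi x^-1%g = - phi x - c x x^-1%g.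
Proof.
move=> hc h; have := h x x^-1%g; rewrite mulgV (trivializes1 hc h) => /eqP.
by rewrite eq_sym addrAC addr_eq0 -opprD => /eqP ->; rewrite opprK.
Qed.

End Trivialization.

(** * The central extension defined by a two-cocycle *)

Section CentralExtension.
Variables (G : groupType) (A : zmodType) (c : G -> G -> A) (hc : two_cocycle c).

(** The cocycle proof is a phantom argument: the group laws depend on it, so the type must carry it
    for the group instance to be found. *)
Definition central_ext of two_cocycle c : Type := (G * A)%type.
Local Notation E := (central_ext hc).
HB.instance Definition _ := Choice.on E.

Definition cext_mul (u v : E) : E := ((u.1 * v.1)%g, u.2 + v.2 + c u.1 v.1).
Definition cext_one : E := (1%g, 0).
Definition cext_inv (u : E) : E := (u.1^-1%g, - u.2 - c u.1 u.1^-1%g).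

Lemma two_cocycleV x : c x^-1%g x = c x x^-1%g.
Proof.
case: hc => c1 c1' cA; have := cA x x^-1%g x.
by rewrite mulgV mulVg c1 c1' !addr0.
Qed.

Fact cext_mulA : associative cext_mul.
Proof.
case: hc => c1 c1' cA [x a] [y b] [z d]; rewrite /cext_mul /= mulgA; congr (_, _).
by rewrite !addrA -[LHS]addrA -cA addrA (addrAC _ d).
Qed.
Fact cext_mul1 : left_id cext_one cext_mul.
Proof. by case: hc => c1 c1' cA [x a]; rewrite /cext_mul /= mul1g add0r c1 addr0. Qed.
Fact cext_1mul : right_id cext_one cext_mul.
Proof. by case: hc => c1 c1' cA [x a]; rewrite /cext_mul /= mulg1 addr0 c1' addr0. Qed.
Fact cext_mulV : left_inverse cext_one cext_inv cext_mul.
Proof.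
move=> [x a]; rewrite /cext_mul /= mulVg two_cocycleV; congr (_, _).
by rewrite addrAC subrK addNr.
Qed.
Fact cext_Vmul : right_inverse cext_one cext_inv cext_mul.
Proof.
by move=> [x a]; rewrite /cext_mul /= mulgV addrA subrr sub0r addNr.
Qed.
HB.instance Definition _ :=
  isGroup.Build E cext_mulA cext_mul1 cext_1mul cext_mulV cext_Vmul.

Definition cext_fst (u : E) : G := u.1.
Fact cext_fstM : {morph cext_fst : u v / (u * v)%g}. Proof. by []. Qed.
HB.instance Definition _ := isMultiplicative.Build E G cext_fst cext_fstM.

Lemma cext_section (f : {multiplicative G -> E}) :
  cext_fst \o f =1 id -> trivializes c (fun x => (f x).2).
Proof.
move=> f1 x y; rewrite gmulfM /=.
by have := f1 x; have := f1 y; rewrite /= /cext_fst => -> ->.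
Qed.

Section Lift.
Variables (G' : groupType) (i : {multiplicative G' -> G}) (phi : G' -> A).
Hypothesis hphi : trivializes (fun x y => c (i x) (i y)) phi.
Definition cext_lift of trivializes (fun x y => c (i x) (i y)) phi :=
  fun x : G' => (i x, phi x) : E.
Fact cext_liftM : {morph cext_lift hphi : x y / (x * y)%g}.
Proof. by move=> x y; rewrite /cext_lift gmulfM hphi. Qed.
HB.instance Definition _ :=
  isMultiplicative.Build G' E (cext_lift hphi) cext_liftM.
End Lift.

End CentralExtension.
Arguments cext_fst {G A c hc} u.

(** Each trivialization is a homomorphism into the extension of [G]; the two agree on the
    amalgamated element, hence glue. *)
Lemma amalgam_trivialization (A : zmodType) (G G1 G2 : groupType)
    (i1 : {multiplicative G1 -> G}) (i2 : {multiplicative G2 -> G}) c1 c2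
    (c : G -> G -> A) (phi1 : G1 -> A) (phi2 : G2 -> A) :
  amalgam i1 i2 c1 c2 -> two_cocycle c ->
  trivializes (fun x y => c (i1 x) (i1 y)) phi1 ->
  trivializes (fun x y => c (i2 x) (i2 y)) phi2 ->
  phi1 c1 = phi2 c2 ->
  exists phi, [/\ trivializes c phi, phi \o i1 =1 phi1 & phi \o i2 =1 phi2].
Proof.
move=> [i12 univ] hc h1 h2 h12.
have [|f [f1 f2 _]] := univ _ (cext_lift hc h1) (cext_lift hc h2).
  by rewrite /= /cext_lift i12 h12.
exists (fun x => (f x).2); split.
- apply: cext_section => x.
  (* The projection of [f] and the identity both restrict to [i1] and [i2], so uniqueness identifies
     them and [f] is a section. *)
  have [g [g1 g2 gU]] := univ G i1 i2 i12.
  have -> : (cext_fst \o f) x = g x.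
    apply: gU => y /=; first by have /= -> := f1 y.
    by have /= -> := f2 y.
  by symmetry; apply: (gU idfun).
- by move=> y; have /= := f1 y => ->.
- by move=> y; have /= := f2 y => ->.
Qed.

(** * Words and relators evaluated in the extension *)

Section WordValue.
Variables (G : groupType) (A : zmodType) (g b : nat) (P : gen g b -> G).

(* The second component of the word [w] evaluated at the lifts [(P s, r s)] to
   the central extension defined by [c]. *)
Fixpoint word_value (c : G -> G -> A) (r : gen g b -> A) (w : word g b) : A :=
  if w is l :: w' then
    (if l.2 then - r l.1 - c (P l.1) (P l.1)^-1%g else r l.1)
    + word_value c r w' + c (letter P l) (eval P w')
  else 0.

Lemma eval_cons (H : groupType) (Q : gen g b -> H) l w :
  eval Q (l :: w) = (letter Q l * eval Q w)%g.
Proof. by rewrite /eval big_cons. Qed.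

Lemma eval_nil (H : groupType) (Q : gen g b -> H) : eval Q [::] = 1%g.
Proof. by rewrite /eval big_nil. Qed.

Lemma word_valueE c (hc : two_cocycle c) r w :
  eval (fun s => (P s, r s) : central_ext hc) w = (eval P w, word_value c r w).
Proof.
elim: w => [|[s e] w IH]; first by rewrite !eval_nil.
by rewrite !eval_cons IH /=; case: e.
Qed.

Lemma presents_trivialization c r : presents P -> two_cocycle c ->
  word_value c r (relator g b) = 0 ->
  exists2 phi, trivializes c phi & forall s, phi (P s) = r s.
Proof.
move=> [P1 univ] hc r1.
have [|f [fP _]] := univ (central_ext hc) (fun s => (P s, r s)).
  by rewrite word_valueE P1 r1.
exists (fun x => (f x).2) => [|s]; last by rewrite fP.
apply: cext_section => x.
have [k [kP kU]] := univ G P P1.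
have -> : (cext_fst \o f) x = k x.
  by apply: kU => s /=; rewrite fP.
by symmetry; apply: (kU idfun).
Qed.

Lemma word_value_trivialized c phi w : two_cocycle c -> trivializes c phi ->
  word_value c (phi \o P) w = phi (eval P w).
Proof.
move=> hc h; elim: w => [|[s e] w IH].
  by rewrite eval_nil (trivializes1 hc h).
rewrite eval_cons h /= IH; congr (_ + _ + _); rewrite /letter /=.
by case: e => //; rewrite (trivializesV _ hc h).
Qed.

(** Since [A] is central, changing the lifts of the generators changes the value only through signed
    exponents. *)
Lemma word_value_shift c r r' w :
  word_value c (fun s => r s + r' s) w
  = word_value c r w + \sum_(l <- w) (if l.2 then - r' l.1 else r' l.1).
Proof.
elim: w => [|[s e] w IH]; first by rewrite big_nil addr0.
rewrite big_cons /= IH; case: e => /=; rewrite [RHS]addrAC; congr (_ + _).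
  by rewrite opprD (addrAC (- r s)) addrACA.
exact: addrACA.
Qed.

Lemma sum_relator (r : gen g b -> A) :
  \sum_(l <- relator g b) (if l.2 then - r l.1 else r l.1)
  = \sum_(j < b) r (genz g j).
Proof.
rewrite /relator big_cat big_flatten /= !big_map /= [index_enum _]unlock.
rewrite big1 ?add0r // => i _.
by rewrite !big_cons big_nil /= addr0 addrA addrACA !subrr addr0.
Qed.

(** Replacing the lifts [(s, 0)] by [(s, phi s)] brings the relator value to [phi 1 = 0]; the
    commutators do not feel the change, so only boundary letters account for it. *)
Lemma relator_value_trivialized c phi :
  presents P -> two_cocycle c -> trivializes c phi ->
  word_value c (fun _ => 0) (relator g b) = - \sum_(j < b) phi (P (genz g j)).
Proof.
move=> [P1 _] hc h; apply/eqP; rewrite -addr_eq0 -(sum_relator (phi \o P)).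
rewrite -word_value_shift -[X in _ == X](trivializes1 hc h) -P1.
rewrite -(word_value_trivialized _ hc h); apply/eqP.
by congr word_value; apply/funext => s; rewrite add0r.
Qed.

(** A boundary generator occurs exactly once in the relator, so its lift can be chosen to kill any
    relator value. *)
Lemma bordered_trivialization (c : G -> G -> A) : presents P -> two_cocycle c -> (0 < b)%N ->
  exists phi, trivializes c phi.
Proof.
move=> hP hc b0; pose j0 := Ordinal b0.
pose v := word_value c (fun _ => 0) (relator g b).
pose r s := if s == genz g j0 then - v else 0.
have [|phi hphi _] := presents_trivialization (r := fun s => 0 + r s) hP hc.
  rewrite word_value_shift sum_relator (bigD1 j0) //= /r eqxx big1.
    by rewrite addr0 subrr.
  by move=> j jj0; rewrite ifN //; apply: contra jj0 => /eqP[->].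
by exists phi.
Qed.

End WordValue.

(** * Cup products of integral classes *)

Section ProductCocycle.
Variables (G : groupType) (R : comNzRingType).

Lemma hom_int1 (f : G -> int) : hom_int f -> f 1%g = 0.
Proof. by move=> hf; have := hf 1%g 1%g; rewrite mulg1 -{1}[f _]addr0 => /addrI. Qed.

Lemma hom_intV (f : G -> int) x : hom_int f -> f x^-1%g = - f x.
Proof.
by move=> hf; apply/eqP; rewrite -addr_eq0 -hf mulVg hom_int1.
Qed.

Definition product_cocycle (f h : G -> int) (x y : G) : R := (f x * h y)%:~R.

Lemma product_cocycleP f h : hom_int f -> hom_int h ->
  two_cocycle (product_cocycle f h).
Proof.
move=> hf hh; split=> [x|x|x y z]; rewrite /product_cocycle.
- by rewrite hom_int1 // mul0r.
- by rewrite (hom_int1 hh) mulr0.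
- rewrite hf hh -!intrD; congr (_%:~R); ring.
Qed.

Lemma word_valueB (c c' : G -> G -> R) (lam : R) g b (P : gen g b -> G) w :
  word_value P (fun x y => c x y - lam * c' x y) (fun _ => 0) w
  = word_value P c (fun _ => 0) w - lam * word_value P c' (fun _ => 0) w.
Proof.
elim: w => [|[s e] w IH] /=; first by rewrite mulr0 subr0.
rewrite IH; case: e; ring.
Qed.

Lemma two_cocycleB (c c' : G -> G -> R) (lam : R) : two_cocycle c ->
  two_cocycle c' -> two_cocycle (fun x y => c x y - lam * c' x y).
Proof.
move=> [h1 h2 h3] [k1 k2 k3]; split=> [x|x|x y z].
- by rewrite h1 k1 mulr0 subrr.
- by rewrite h2 k2 mulr0 subrr.
- by rewrite [LHS]addrACA [RHS]addrACA -!opprD -!mulrDr h3 k3.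
Qed.

Lemma trivializesB (c c' : G -> G -> R) (lam : R) (phi psi : G -> R) :
  trivializes c phi -> trivializes c' psi ->
  trivializes (fun x y => c x y - lam * c' x y) (fun x => phi x - lam * psi x).
Proof. move=> h k x y; rewrite h k; ring. Qed.

(** The extension is of Heisenberg type: the commutator of lifts of [x] and [y] is central with
    value [f x * h y - f y * h x], and the boundary letters contribute nothing. *)
Lemma relator_value_product (S : surface G) (f h : G -> int) :
  hom_int f -> hom_int h ->
  (forall j : 'I_(nbd S), f (bd j) = 0) -> (forall j : 'I_(nbd S), h (bd j) = 0) ->
  word_value (@gens _ S) (product_cocycle f h) (fun _ => 0) (relator _ _)
  = (intersection S f h)%:~R.
Proof.
move=> hf hh f0 h0; rewrite /relator /intersection -[\sum_(i < _) _]big_enum /=.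
elim: (enum 'I_(genus S)) => [|i s IH].
  rewrite big_nil /=; elim: (enum 'I_(nbd S)) => //= j s ->.
  by rewrite /product_cocycle /letter /= -/(bd j) f0 mul0r !addr0.
rewrite big_cons intrD -IH /= !eval_cons /letter /product_cocycle /=.
rewrite !hh !(hom_intV _ hh) !(hom_intV _ hf); set W := eval _ _.
set v := word_value _ _ _ _.
rewrite /genx /geny !(intrM, intrD, intrN, mulrNz).
ring.
Qed.

End ProductCocycle.

(** * Linear extension to the group ring *)

Section FreeLift.
Variables (R : nzRingType) (K : choiceType) (M : lmodType R).

HB.instance Definition _ (f : K -> M) :=
  GRing.isZmodMorphism.Build {freeg K / R} M (fglift f) (@lift_is_additive R K M f).

Lemma freeg_additive_ext (N : zmodType) (f g : {additive {freeg K / R} -> N}) :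
  (forall k x, f << k *g x >> = g << k *g x >>) -> f =1 g.
Proof.
move=> fg D; rewrite -[D]freeg_sumE !raddf_sum; apply: eq_bigr => x _.
exact: fg.
Qed.

Lemma freegUZ (k k' : R) (x : K) : k *: << k' *g x >> = << (k * k') *g x >>.
Proof. by apply/eqP/freeg_eqP => y; rewrite coeffZ !coeffU mulrA. Qed.

End FreeLift.

Section FreeLiftLinear.
Variables (R : nzRingType) (K : choiceType) (M : lmodType R) (f : K -> M).

Fact fglift_is_scalable : scalable (fglift f).
Proof.
move=> k; apply: (@freeg_additive_ext _ _ _ (fglift f \o *:%R k)
  ( *:%R k \o fglift f)) => k' x /=.
by rewrite freegUZ !liftU scalerA.
Qed.
HB.instance Definition _ :=
  GRing.isScalable.Build R {freeg K / R} M *:%R (fglift f) fglift_is_scalable.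

End FreeLiftLinear.

(** * The invariant trace form *)

Section TraceForm.
Variables (R : realType) (n : nat).
Implicit Types X Y Z : sl R n.

Lemma trformC X Y : trform X Y = trform Y X.
Proof. by rewrite /trform mxtrace_mulC. Qed.

Fact trform_is_linear X : linear_for *%R (trform X).
Proof.
by move=> k Y Z; rewrite /trform /= mulmxDr -scalemxAr mxtraceD mxtraceZ.
Qed.
HB.instance Definition _ X :=
  GRing.isLinear.Build R (sl R n) R _ (trform X) (trform_is_linear X).

Lemma trformDl X Y Z : trform (X + Y) Z = trform X Z + trform Y Z.
Proof. by rewrite -!(trformC Z) raddfD. Qed.
Lemma trformNl X Z : trform (- X) Z = - trform X Z.
Proof. by rewrite -!(trformC Z) raddfN. Qed.
Lemma trformBl X Y Z : trform (X - Y) Z = trform X Z - trform Y Z.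
Proof. by rewrite trformDl trformNl. Qed.
Lemma trform0l Z : trform 0 Z = 0.
Proof. by rewrite trformC raddf0. Qed.

Lemma trform_Ad p X Y : trform (Ad p X) (Ad p Y) = trform X Y.
Proof.
rewrite /trform /= mulmxA -(mulmxA _ (invmx _)) (mulmxA (invmx _)) mulVmx ?SL_unit //.
rewrite mul1mx mxtrace_mulC !mulmxA mulVmx ?SL_unit // mul1mx.
by rewrite mxtrace_mulC.
Qed.

End TraceForm.

(** * The cup product of two cocycles with values in the Lie algebra *)

Section Cocycles.
Variables (R : realType) (n : nat) (G : groupType) (rho : rep R n G).
Implicit Types (a b : Z1 rho) (x y z u : G) (X Y : sl R n).

Lemma Z1M a x y : val a (x * y)%g = val a x + Ad (rho x) (val a y).
Proof. by case: a => a /= /asboolP. Qed.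

Lemma Z1V a x : val a x^-1%g = - Ad (rho x^-1%g) (val a x).
Proof. by apply/eqP; rewrite -addr_eq0 -Z1M mulVg cocycle1. Qed.

Lemma Ad_repK x X : Ad (rho x^-1%g) (Ad (rho x) X) = X.
Proof. by rewrite -AdM -gmulfM mulVg rep1 Ad1. Qed.

Lemma Ad_repVK x X : Ad (rho x) (Ad (rho x^-1%g) X) = X.
Proof. by rewrite -AdM -gmulfM mulgV rep1 Ad1. Qed.

Lemma trform_Adl x X Y : trform (Ad (rho x) X) Y = trform X (Ad (rho x^-1%g) Y).
Proof. by rewrite -{1}[Y](Ad_repVK x) trform_Ad. Qed.

Definition cup_cocycle a b x y : R := trform (val a x) (Ad (rho x) (val b y)).

Lemma cup_cocycleP a b : two_cocycle (cup_cocycle a b).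
Proof.
split=> [x|x|x y z]; rewrite /cup_cocycle.
- by rewrite cocycle1 trform0l.
- by rewrite cocycle1 !raddf0.
- rewrite !Z1M !raddfD /= trformDl gmulfM AdM trform_Ad addrA addrAC.
  by rewrite -!addrA addrC -!addrA; congr (_ + _); rewrite addrC.
Qed.

End Cocycles.

(** * Fox calculus and the fundamental class *)

Section FoxCalculus.
Variables (R : realType) (n : nat) (G : groupType) (rho : rep R n G).
Variables (g b : nat) (P : gen g b -> G).
Implicit Types (D : {freeg G / R}) (x : G).

Lemma fglift_gr (M : lmodType R) (f : G -> M) x : fglift f (gr R x) = f x.
Proof. by rewrite liftU scale1r. Qed.

Lemma fglift_lmul (M : lmodType R) (f : G -> M) x D :
  fglift f (gr_lmul x D) = fglift (fun y => f (x * y)%g) D.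
Proof.
apply: (freeg_additive_ext (f := fglift f \o fglift (fun y => gr R (x * y)%g))).
by move=> k y /=; rewrite !liftU linearZ /= fglift_gr.
Qed.

Lemma fglift_bar (M : lmodType R) (f : G -> M) D :
  fglift f (gr_bar D) = fglift (fun y => f y^-1%g) D.
Proof.
apply: (freeg_additive_ext (f := fglift f \o fglift (fun y => gr R y^-1%g))).
by move=> k y /=; rewrite !liftU linearZ /= fglift_gr.
Qed.

Lemma fgliftD (M : lmodType R) (f f' : G -> M) D :
  fglift (fun x => f x + f' x) D = fglift f D + fglift f' D.
Proof.
apply: (freeg_additive_ext (f := fglift _) (g := fglift f \+ fglift f')).
by move=> k y /=; rewrite !liftU scalerDr.
Qed.

Lemma fglift_comp (M N : lmodType R) (h : {linear M -> N}) (f : G -> M) D :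
  h (fglift f D) = fglift (h \o f) D.
Proof.
apply: (freeg_additive_ext (f := h \o fglift f)).
by move=> k y /=; rewrite !liftU linearZ.
Qed.

Implicit Types (al be : Z1 rho) (w : word g b).

(** This is Fox's formula, [w - 1] as the sum of the [(dw/ds)(s - 1)], seen through a cocycle;
    prefixing a letter acts on both sides by the cocycle rule. *)
Lemma fundamental_formula be w :
  \sum_s fglift (fun x => Ad (rho x) (val be (P s))) (fox R P s w)
  = val be (eval P w).
Proof.
elim: w => [|[s e] w IH].
  by rewrite eval_nil cocycle1 big1 // => s _; rewrite raddf0.
rewrite eval_cons Z1M -IH raddf_sum /=; set x := letter P _.
have foxE s' : fglift (fun y => Ad (rho y) (val be (P s'))) (fox R P s' ((s, e) :: w))
    = fglift (fun y => Ad (rho y) (val be (P s')))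
        (if s == s' then if e then - gr R (P s)^-1%g else gr R 1%g else 0)
      + Ad (rho x) (fglift (fun y => Ad (rho y) (val be (P s'))) (fox R P s' w)).
  rewrite /= raddfD /= fglift_lmul fglift_comp /=.
  congr (_ + _); first by case: eqP => [->|].
  by congr fglift; apply/funext => y /=; rewrite gmulfM AdM.
rewrite (eq_bigr _ (fun s' _ => foxE s')) big_split /=; congr (_ + _).
rewrite (bigD1 s) //= eqxx big1 ?addr0 => [|s' /negPf ss']; last first.
  by rewrite eq_sym ss' raddf0.
rewrite {foxE}/x /letter; case: e => /=.
  by rewrite raddfN /= fglift_gr Z1V.
by rewrite fglift_gr rep1 Ad1.
Qed.

(** This identifies the Fox formula for the cup product with a word value in the extension:
    prefixing a letter [x] to [w] adds the letter's own term and [cup_cocycle al be x w]. *)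
Lemma cup_word_value al be w :
  - \sum_s trform (fglift (val al) (gr_bar (fox R P s w))) (val be (P s))
  = word_value P (cup_cocycle al be) (fun _ => 0) w.
Proof.
elim: w => [|[s e] w IH].
  rewrite big1 ?oppr0 // => s _.
  by rewrite fglift_bar raddf0 trform0l.
rewrite [RHS]/= -IH /cup_cocycle -fundamental_formula; set x := letter P _.
(* The bar turns [x * y] into [y^-1 * x^-1], where the cocycle rule splits off the last summand. *)
have foxE s' : fglift (val al) (gr_bar (fox R P s' ((s, e) :: w)))
    = (if s == s' then if e then - val al (P s) else 0 else 0)
      + fglift (val al) (gr_bar (fox R P s' w))
      + fglift (fun y => Ad (rho y^-1%g) (val al x^-1%g)) (fox R P s' w).
  rewrite /= !fglift_bar raddfD /= fglift_lmul /= -addrA; congr (_ + _).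
    case: eqP => [->|]; last by rewrite raddf0.
    by case: e {x}; rewrite ?raddfN /= fglift_gr ?invgK ?invg1 ?cocycle1.
  rewrite -fgliftD; congr fglift; apply/funext => y.
  by rewrite invgM Z1M.
rewrite (eq_bigr _ (fun s' _ => congr1 (fun X => trform X _) (foxE s'))).
under eq_bigr do rewrite !trformDl.
rewrite !big_split /= !opprD; congr (_ + _ + _).
  rewrite (bigD1 s) //= eqxx big1 ?addr0 => [|s' /negPf ss']; last first.
    by rewrite eq_sym ss' trform0l.
  case: e {x foxE}; last by rewrite trform0l oppr0.
  by rewrite trformNl Z1V !raddfN /= Ad_repVK !opprK oppr0 add0r.
(* By invariance of the trace form each split-off term pairs [al x^-1] with a summand of the
   fundamental formula for [be] at [w]. *)
rewrite -sumrN !raddf_sum /=; apply: eq_bigr => s' _.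

rewrite trformC.
apply: (freeg_additive_ext (f := -%R \o trform _ \o fglift _)
  (g := trform _ \o Ad _ \o fglift _)) => k y /=.
rewrite !liftU !linearZ /= -mulrN; congr (_ * _).
by rewrite Z1V !raddfN /= opprK -!trform_Adl trformC.
Qed.

End FoxCalculus.

(** * Boundary terms and their invariance *)

Section BoundaryTerm.
Variables (R : realType) (n : nat) (G : groupType) (rho : rep R n G).
Implicit Types (a b : Z1 rho) (x y z u : G) (X Y : sl R n).

(** For a cocycle, the same [X] then works on all of [<z>]. *)
Definition cobd_at a z : Prop := exists X, val a z = cobd rho X z.

Lemma cobdB X Y z : cobd rho (X - Y) z = cobd rho X z - cobd rho Y z.
Proof. by rewrite /cobd raddfB /= !opprD !opprK addrACA. Qed.

Lemma primitiveP a z : cobd_at a z -> val a z = cobd rho (primitive a z) z.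
Proof. by case=> X hX; rewrite /primitive; case: xgetP => [|/(_ X)//]. Qed.

(* When [a] and [b] are coboundaries on [<z>], the map
   [x |-> - trform (primitive a z) (b x)] trivializes the cup product on [<z>];
   this is the difference at [z] between [phi] and that local trivialization. *)
Definition boundary_term a b (phi : G -> R) z : R :=
  phi z + trform (primitive a z) (val b z).

(** Two primitives of [a] at [z] differ by a vector fixed by [z], which invariance makes orthogonal
    to [b z = z . W - W]. *)
Lemma boundary_termE a b phi z X :
  val a z = cobd rho X z -> cobd_at b z ->
  boundary_term a b phi z = phi z + trform X (val b z).
Proof.
move=> aX [W bW]; congr (_ + _); have := primitiveP (ex_intro _ X aX).
set X' := primitive a z; rewrite aX /cobd => XX'.
have zD : Ad (rho z) (X' - X) = X' - X.
  have -> : Ad (rho z) (X' - X) = Ad (rho z) X' - X' + X' - Ad (rho z) X.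
    by rewrite raddfB /= subrK.
  by rewrite -XX' addrAC (addrAC _ (- X)) subrr add0r addrC.
apply/eqP; rewrite -subr_eq0 -trformBl bW /cobd raddfB /= -{1}zD trform_Ad.
by rewrite subrr.
Qed.

Lemma cobd_at_conj a u z : cobd_at a z -> cobd_at a (u * z * u^-1)%g.
Proof.
by case=> X aX; eexists; have := cocycle_conj u^-1%g aX; rewrite invgK; apply.
Qed.

Lemma cobd_atV a z X : val a z = cobd rho X z -> val a z^-1%g = cobd rho X z^-1%g.
Proof. by move=> aX; rewrite Z1V aX /cobd raddfB /= Ad_repK opprB. Qed.

Variables (a b : Z1 rho) (phi : G -> R).
Hypothesis hphi : trivializes (cup_cocycle a b) phi.

(** With [X] fixed, the boundary term is a difference of two trivializations of one cocycle on
    [<z>], hence a homomorphism there. *)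
Lemma boundary_termV z : cobd_at a z -> cobd_at b z ->
  boundary_term a b phi z^-1%g = - boundary_term a b phi z.
Proof.
move=> [X aX] [Y bY]; rewrite (boundary_termE _ (cobd_atV aX)); last first.
  by exists Y; apply: cobd_atV.
rewrite (boundary_termE _ aX); last by exists Y.
rewrite (trivializesV _ (cup_cocycleP a b) hphi) /cup_cocycle !Z1V !raddfN /=.
rewrite Ad_repVK aX -trform_Adl /cobd trformBl; ring.
Qed.

(** Conjugation in the extension carries the canonical splitting over [<z>] to the one over the
    conjugate subgroup. *)
Lemma boundary_term_conj u z : cobd_at a z -> cobd_at b z ->
  boundary_term a b phi (u * z * u^-1)%g = boundary_term a b phi z.
Proof.
move=> [X aX] bz; set w := (u * z * u^-1)%g.
have aw : val a w = cobd rho (Ad (rho u) X - val a u) w.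
  rewrite /w !Z1M Z1V aX /cobd !raddfB !raddfN /= -!AdM -!gmulfM.
  rewrite -!mulgA mulVg mulg1 !gmulfM !AdM.
  by rewrite opprK (addrC _ (sval a u)) [LHS]addrAC [RHS]addrAC addrCA [LHS]addrAC.

rewrite (boundary_termE _ aw); last exact: cobd_at_conj.
rewrite (boundary_termE _ aX) // {1}/w !hphi.
rewrite (trivializesV _ (cup_cocycleP a b) hphi) /cup_cocycle.
rewrite /w !Z1M Z1V !raddfN /= Ad_repVK aX.
have E Y : Ad (rho (u * z)%g) (Ad (rho u^-1%g) Y) = Ad (rho w) Y.
  by rewrite -AdM -gmulfM.
rewrite E !trformBl !trformDl !raddfD !raddfN /= /cobd.
have F : Ad (rho u) (Ad (rho z) X) = Ad (rho w) (Ad (rho u) X).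
  by rewrite -!AdM -!gmulfM mulgVK.
rewrite F trformBl !trform_Ad; ring.
Qed.

End BoundaryTerm.

(** * The pairing on a surface with boundary *)

Section OmegaBordered.
Variables (R : realType) (n : nat) (G : groupType) (rho : rep R n G).
Implicit Types (a b : Z1 rho) (x y z u : G) (X Y : sl R n).

Lemma omega_boundary_terms (S : surface G) a b phi :
  trivializes (cup_cocycle a b) phi ->
  omega_Z1 S a b = - \sum_(j < nbd S) boundary_term a b phi (bd j).
Proof.
move=> hphi; rewrite /omega_Z1 /cup cup_word_value.
rewrite (relator_value_trivialized (gens_presents S) (cup_cocycleP a b) hphi).
by rewrite /boundary_term big_split opprD.
Qed.

(** Subtracting the coboundary of [Y] from [a] adds [trform Y (b x)] to [phi] and replaces each
    primitive [X] by [X - Y]; the two changes cancel at every boundary curve. *)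
Lemma omega_bordered_cohomologous_l (S : surface G) a a' b : (0 < nbd S)%N ->
  (forall j : 'I_(nbd S), cobd_at a (bd j) /\ cobd_at b (bd j)) ->
  cohomologous a a' -> omega_Z1 S a b = omega_Z1 S a' b.
Proof.
move=> b0 hab /asboolP[Y aa'].
have [phi hphi] := bordered_trivialization (gens_presents S) (cup_cocycleP a b) b0.
have a'E x : val a' x = val a x - cobd rho Y x by rewrite -aa' opprB addrC subrK.
have hphi' : trivializes (cup_cocycle a' b) (fun x => phi x + trform Y (val b x)).
  move=> x y; rewrite hphi /cup_cocycle a'E /cobd !trformBl trform_Ad Z1M raddfD /=.
  ring.
rewrite (omega_boundary_terms _ hphi) (omega_boundary_terms _ hphi').
congr (- _); apply: eq_bigr => j _; have [[X aX] bz] := hab j.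
have a'X : val a' (bd j) = cobd rho (X - Y) (bd j).
  by rewrite a'E aX cobdB.
rewrite (boundary_termE _ aX) // (boundary_termE _ a'X) // trformBl.
by rewrite addrAC -addrA subrK.
Qed.

Lemma omega_bordered_cohomologous_r (S : surface G) a b b' : (0 < nbd S)%N ->
  (forall j : 'I_(nbd S), cobd_at a (bd j) /\ cobd_at b (bd j)) ->
  cohomologous b b' -> omega_Z1 S a b = omega_Z1 S a b'.
Proof.
move=> b0 hab /asboolP[Y bb'].
have [phi hphi] := bordered_trivialization (gens_presents S) (cup_cocycleP a b) b0.
have b'E x : val b' x = val b x - cobd rho Y x by rewrite -bb' opprB addrC subrK.
have hphi' : trivializes (cup_cocycle a b')
    (fun x => phi x - trform (val a x) (Ad (rho x) Y)).
  move=> x y; rewrite hphi /cup_cocycle b'E /cobd !raddfB !Z1M !trformDl /=.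
  rewrite gmulfM AdM trform_Ad; ring.
rewrite (omega_boundary_terms _ hphi) (omega_boundary_terms _ hphi').
congr (- _); apply: eq_bigr => j _; have [[X aX] [W bW]] := hab j.
have b'W : val b' (bd j) = cobd rho (W - Y) (bd j).
  by rewrite b'E bW cobdB.
rewrite (boundary_termE _ aX); last by exists W.
rewrite (boundary_termE _ aX); last by exists (W - Y).
rewrite b'E aX /cobd !raddfB /= !trformBl trform_Ad; ring.
Qed.

End OmegaBordered.

Lemma multiplicativeV (G H : groupType) (f : {multiplicative G -> H}) x :
  f x^-1%g = (f x)^-1%g.
Proof.
have f1 : f 1%g = 1%g by apply: (mulgI (f 1%g)); rewrite -gmulfM !mulg1.
by apply: (mulgI (f x)); rewrite -gmulfM !mulgV f1.
Qed.

(** Frees the pairing from the representatives chosen by [repr]; it serves for the two pieces, which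
    always have boundary. *)
Lemma omegaK_pi (R : realType) (n : nat) (G : groupType) (rho : rep R n G)
    (S : surface G) (a b : Z1 rho) : (0 < nbd S)%N ->
  (forall j : 'I_(nbd S), cobd_at a (bd j) /\ cobd_at b (bd j)) ->
  omegaK S (\pi_(H1 rho) a)%qT (\pi_(H1 rho) b)%qT = omega_Z1 S a b.
Proof.
move=> b0 hab; rewrite /omegaK.
have reprE (d : Z1 rho) : cohomologous d (repr (\pi_(H1 rho) d)%qT).
  by have /eqmodP := esym (reprK (\pi_(H1 rho) d)%qT).
rewrite (omega_bordered_cohomologous_l b0 hab (reprE a)).
apply/esym/(omega_bordered_cohomologous_r b0) => // j.
have [[X aX] bz] := hab j; split=> //.
have /asboolP[Y aY] := reprE a; exists (X - Y).
by rewrite cobdB -aX -aY opprB addrC subrK.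
Qed.

(** * Restriction to a subsurface *)

Section Subsurface.
Variables (R : realType) (n : nat) (G G' G'' : groupType) (rho : rep R n G).
Variables (S : surface G) (S' : surface G').
Variables (i' : {multiplicative G' -> G}) (i'' : G'' -> G) (xi : G) (e : bool).
Variables (t : 'I_(nbd S') -> option 'I_(nbd S)).
Hypothesis hsub : subsurface i' i'' (orient xi e) t.
Implicit Types (a b : Z1 rho).

Lemma subsurface_bordered : (0 < nbd S')%N.
Proof. by have [[k /= kb] _] := sub_xi_bd hsub; apply: leq_trans kb. Qed.

Lemma cobd_at_orient a : cobd_at a xi -> cobd_at a (orient xi e).
Proof. by case: e => // -[X aX]; exists X; apply: cobd_atV. Qed.

Lemma subsurface_xiV (k : 'I_(nbd S')) : t k = None ->
  exists u, i' (bd k) = (u * orient xi e * u^-1)%g.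
Proof.
move=> tk; have [u ->] := sub_xi hsub tk; exists (i' u)^-1%g.
by rewrite invgK !gmulfM multiplicativeV -!mulgA mulVg mulg1 mulKg.
Qed.

Lemma cobd_at_subsurface a (k : 'I_(nbd S')) :
  (forall j : 'I_(nbd S), cobd_at a (bd j)) -> cobd_at a xi ->
  cobd_at (res_Z1 i' a) (bd k).
Proof.
move=> abd axi; suff [X aX] : cobd_at a (i' (bd k)) by exists X.
case tk : (t k) => [j|].
  by have [u ->] := sub_bd hsub tk; apply: cobd_at_conj.
by have [u ->] := subsurface_xiV tk; apply/cobd_at_conj/cobd_at_orient.
Qed.

(** A trivialization over [G] pulls back along [i'], and boundary terms, being conjugation
    invariant, can be computed on the curves of [S]. *)
Lemma omega_subsurface a b phi :
  (forall j : 'I_(nbd S), cobd_at a (bd j)) -> cobd_at a xi ->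
  (forall j : 'I_(nbd S), cobd_at b (bd j)) -> cobd_at b xi ->
  trivializes (cup_cocycle a b) phi ->
  omega_Z1 S' (res_Z1 i' a) (res_Z1 i' b)
  = - \sum_k boundary_term a b phi (if t k is Some j then bd j else orient xi e).
Proof.
move=> abd axi bbd bxi hphi.
have hphi' : trivializes (cup_cocycle (res_Z1 i' a) (res_Z1 i' b)) (phi \o i').
  by move=> x y; rewrite /= gmulfM hphi.
rewrite (omega_boundary_terms _ hphi'); congr (- _); apply: eq_bigr => k _.
have [X aX] := cobd_at_subsurface k abd axi.
rewrite (boundary_termE _ aX); last exact: cobd_at_subsurface.
have bk := cobd_at_subsurface k bbd bxi.
rewrite -[LHS](@boundary_termE _ _ _ _ a b phi (i' (bd k)) X) //.
case tk : (t k) => [j|].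
  by have [u ->] := sub_bd hsub tk; apply: boundary_term_conj.
by have [u ->] := subsurface_xiV tk; apply: boundary_term_conj => //;
   apply: cobd_at_orient.
Qed.

Lemma sum_subsurface (A : nmodType) (F : option 'I_(nbd S) -> A) :
  \sum_k F (t k) = F None + \sum_(j | Some j \in codom t) F (Some j).
Proof.
have -> : \sum_k F (t k) = \sum_(o in codom t) F o.
  have t_uniq : uniq (codom t).
    by rewrite map_inj_uniq ?enum_uniq //; apply: sub_bd_inj hsub.
  by rewrite -(big_uniq _ t_uniq) big_map -[LHS]big_enum.
have [k0 tk0] := sub_xi_bd hsub.
rewrite (bigD1 None) /=; last by rewrite -tk0 codom_f.
congr (_ + _); rewrite (reindex_omap Some id) /=; last by case=> //= /andP[].
by apply: eq_bigl => j; rewrite eqxx !andbT.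
Qed.

End Subsurface.

(** * Integral classes as trivializations of the zero cocycle *)

Lemma presents_hom_int (G : groupType) (g b : nat) (P : gen g b -> G)
    (r : gen g b -> int) : presents P -> (forall j, r (genz g j) = 0) ->
  exists2 f, hom_int f & forall s, f (P s) = r s.
Proof.
move=> hP r0; pose c (_ _ : G) : int := 0.
have hc : two_cocycle c by split.
have [|f hf fP] := presents_trivialization (r := fun s => 0 + r s) hP hc.
  rewrite word_value_shift sum_relator big1 // addr0.
  by elim: (relator g b) => //= -[s [] w ->]; rewrite ?oppr0 !addr0.
exists f => [x y|s]; first by rewrite hf addr0.
by rewrite fP add0r.
Qed.

Lemma amalgam_hom_int (G G1 G2 : groupType)
    (i1 : {multiplicative G1 -> G}) (i2 : {multiplicative G2 -> G}) c1 c2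
    (f1 : G1 -> int) :
  amalgam i1 i2 c1 c2 -> hom_int f1 -> f1 c1 = 0 ->
  exists f, [/\ hom_int f, f \o i1 =1 f1 & forall x, f (i2 x) = 0].
Proof.
move=> ham hf1 f10; pose c (_ _ : G) : int := 0.
have hc : two_cocycle c by split.
have h1 : trivializes (fun x y => c (i1 x) (i1 y)) f1.
  by move=> x y; rewrite hf1 addr0.
have h2 : trivializes (fun x y => c (i2 x) (i2 y)) (fun _ => 0) by [].
have [f [hf fi1 fi2]] := amalgam_trivialization ham hc h1 h2 f10.
by exists f; split=> // x y; rewrite hf addr0.
Qed.

Lemma trivializes_product_conj (G : groupType) (R : comNzRingType)
    (f h : G -> int) (psi : G -> R) u z : hom_int f -> hom_int h ->
  trivializes (product_cocycle R f h) psi -> f z = 0 -> h z = 0 ->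
  psi (u * z * u^-1)%g = psi z.
Proof.
move=> hf hh hpsi fz hz; have hc := product_cocycleP R hf hh.
rewrite !hpsi (trivializesV _ hc hpsi) /product_cocycle hf fz hz.
by rewrite addr0 mulr0 mulr0z; ring.
Qed.

(** * Additivity, with boundary and closed *)

Section Additivity.
Variables (R : realType) (n : nat) (G G1 G2 : groupType) (rho : rep R n G).
Variables (S : surface G) (S1 : surface G1) (S2 : surface G2).
Variables (i1 : {multiplicative G1 -> G}) (i2 : {multiplicative G2 -> G}).
Variables (xi : G) (e : bool).
Variables (t1 : 'I_(nbd S1) -> option 'I_(nbd S)).
Variables (t2 : 'I_(nbd S2) -> option 'I_(nbd S)).
Hypothesis hsep : separates i1 i2 xi e t1 t2.
Variables a b : Z1 rho.
Hypotheses (abd : forall j : 'I_(nbd S), cobd_at a (bd j)) (axi : cobd_at a xi).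
Hypotheses (bbd : forall j : 'I_(nbd S), cobd_at b (bd j)) (bxi : cobd_at b xi).

Lemma omega_additive_bordered : (0 < nbd S)%N ->
  omega_Z1 S a b = omega_Z1 S1 (res_Z1 i1 a) (res_Z1 i1 b)
                   + omega_Z1 S2 (res_Z1 i2 a) (res_Z1 i2 b).
Proof.
move=> b0; have [phi hphi] :=
  bordered_trivialization (gens_presents S) (cup_cocycleP a b) b0.
rewrite (omega_boundary_terms _ hphi).
rewrite (omega_subsurface (sep_sub1 hsep) abd axi bbd bxi hphi).
rewrite (omega_subsurface (sep_sub2 hsep) abd axi bbd bxi hphi).
pose F e' (o : option 'I_(nbd S)) :=
  boundary_term a b phi (if o is Some j then bd j else orient xi e').
rewrite (sum_subsurface (sep_sub1 hsep) (F e)).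
rewrite (sum_subsurface (sep_sub2 hsep) (F (~~ e))) /=.
(* The two sides induce opposite orientations on [xi]. *)
have -> : F (~~ e) None = - F e None.
  rewrite /F /orient; have := boundary_termV hphi axi bxi.
  by case: (e) => /= ->; rewrite ?opprK.
rewrite -!opprD addrACA subrr add0r; congr (- _).
rewrite (bigID (fun j => Some j \in codom t1)) /=; congr (_ + _).
apply: eq_bigl => j; apply/idP/idP => [jt1|/codomP[k tk]].
  apply: contraT => jt2; have [|k tk] := (sep_bd hsep j).2.
    by move=> [k tk]; rewrite -tk codom_f in jt2.
  by rewrite -tk codom_f in jt1.
apply/negP => /codomP[k' tk'].
by apply: (sep_bd hsep j).1; [exists k'|exists k].
Qed.

(** For closed [S], the curve [xi] is the only boundary of [S']. Here [phi] lives on [G'] alone,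
    since the cup product need not be trivial over [G]; the sign records the orientation of [xi]. *)
Lemma omega_cut (G' G'' : groupType) (S' : surface G')
    (i' : {multiplicative G' -> G}) (i'' : G'' -> G) (e' : bool)
    (t : 'I_(nbd S') -> option 'I_(nbd S)) (c : G') (phi : G' -> R) (X : sl R n) :
  nbd S = 0%N -> subsurface i' i'' (orient xi e') t -> i' c = xi ->
  trivializes (cup_cocycle (res_Z1 i' a) (res_Z1 i' b)) phi ->
  val a xi = cobd rho X xi ->
  omega_Z1 S' (res_Z1 i' a) (res_Z1 i' b)
  = - ((-1) ^+ e' * (phi c + trform X (val b xi))).
Proof.
move=> S0 hsub ic hphi aX; have [k0 tk0] := sub_xi_bd hsub.
have tN k : t k = None by case: (t k) => // -[m lt_m]; exfalso; rewrite S0 in lt_m.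
have kk0 k : k = k0 by apply: (sub_bd_inj hsub); rewrite !tN.
have cX : val (res_Z1 i' a) c = cobd (res_rep rho i') X c.
  by move: aX; rewrite -ic.
have ac : cobd_at (res_Z1 i' a) c by exists X.
have [Y cY] : cobd_at (res_Z1 i' b) c by move: bxi; rewrite -ic.
have bc : cobd_at (res_Z1 i' b) c by exists Y.
rewrite (omega_boundary_terms _ hphi) (bigD1 k0) //= big1 ?addr0; last first.
  by move=> k; rewrite (kk0 k) eqxx.
have [u /esym uE] := sub_xi hsub tk0.
have cE : (u * bd k0 * u^-1)%g = orient c e'.
  apply: (sub_inj hsub); rewrite uE /orient; case: (e'); last by rewrite ic.
  by rewrite multiplicativeV ic.
have kE : bd k0 = (u^-1 * orient c e' * u^-1^-1)%g.
  by rewrite -cE invgK -!mulgA mulVg mulg1 mulKg.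
rewrite kE (boundary_term_conj hphi); first last.
- by case: (e') => //; exists Y; apply: cobd_atV.
- by case: (e') => //; exists X; apply: cobd_atV.
have <- : boundary_term (res_Z1 i' a) (res_Z1 i' b) phi c = phi c + trform X (val b xi).
  by rewrite (boundary_termE _ cX) //= ic.
by case: (e'); rewrite /orient ?mul1r // (boundary_termV hphi ac bc) mulN1r.
Qed.

Lemma omega_additive_closed : nbd S = 0%N ->
  omega_Z1 S a b = omega_Z1 S1 (res_Z1 i1 a) (res_Z1 i1 b)
                   + omega_Z1 S2 (res_Z1 i2 a) (res_Z1 i2 b).
Proof.
move=> S0; have [X aX] := axi.
have hsub1 := sep_sub1 hsep; have hsub2 := sep_sub2 hsep.
have [c1 [c2 [i1c ham]]] := sep_amalgam hsep.
have i2c : i2 c2 = xi by rewrite -ham.1.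
have b1 := subsurface_bordered hsub1; have b2 := subsurface_bordered hsub2.
have [phi1 hphi1] := bordered_trivialization (gens_presents S1)
  (cup_cocycleP (res_Z1 i1 a) (res_Z1 i1 b)) b1.
have [phi2 hphi2] := bordered_trivialization (gens_presents S2)
  (cup_cocycleP (res_Z1 i2 a) (res_Z1 i2 b)) b2.
have om1 := omega_cut S0 hsub1 i1c hphi1 aX.
have om2 := omega_cut S0 hsub2 i2c hphi2 aX.
set lam := (X in _ = X).
(* The terms in [X] cancel by orientation, leaving up to sign the mismatch of the two splittings at
   [xi]. *)
have lamE : lam = (-1) ^+ e * (phi2 c2 - phi1 c1).
  by rewrite /lam om1 om2 signrN; ring.
have no_bd : 'I_(nbd S) -> False by rewrite S0 => -[].
have [k0 tk0] := sub_xi_bd hsub1.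
have kk0 k : k = k0.
  by apply: (sub_bd_inj hsub1); rewrite tk0; case: (t1 k) => // j; case: (no_bd j).
have [u uE] : exists u, orient c1 e = (u * bd k0 * u^-1)%g.
  have [u uE] := sub_xi hsub1 tk0; exists u; apply: (sub_inj hsub1).
  by rewrite -uE /orient; case: (e); rewrite ?multiplicativeV i1c.
(* With a single boundary component, hyperbolicity excludes genus 0; a handle is needed to carry
   [f1] and [h1]. *)
have genus1 : (0 < genus S1)%N.
  have nbd1 : nbd S1 = 1%N.
    rewrite -[nbd S1]card_ord -(card1 k0); apply: eq_card => k.
    by rewrite !inE (kk0 k) eqxx.
  by have := surface_hyperbolic S1; rewrite nbd1; case: (genus S1).
pose s0 := Ordinal genus1.
have hom_c1 (f : G1 -> int) : hom_int f -> 
      (forall j : 'I_(nbd S1), f (bd j) = 0) -> f c1 = 0.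
  move=> hf fz; have : f (orient c1 e) = 0.
    by rewrite uE !hf hom_intV // fz addr0 subrr.
  by rewrite /orient; case: (e); rewrite ?hom_intV // => /eqP; rewrite oppr_eq0 => /eqP.
(* [f1] and [h1] are dual to the two generators of the handle [s0], so their intersection number is
   1. *)
have [|f1 hf1 f1P] := presents_hom_int
  (r := fun s => (s == genx _ s0)%:R) (gens_presents S1); first by [].
have [|h1 hh1 h1P] := presents_hom_int
  (r := fun s => (s == geny _ s0)%:R) (gens_presents S1); first by [].
have f1z (j : 'I_(nbd S1)) : f1 (bd j) = 0 by rewrite f1P.
have h1z (j : 'I_(nbd S1)) : h1 (bd j) = 0 by rewrite h1P.
have [f [hf fi1 fi2]] := amalgam_hom_int ham hf1 (hom_c1 _ hf1 f1z).
have [h [hh hi1 hi2]] := amalgam_hom_int ham hh1 (hom_c1 _ hh1 h1z).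
have I1 : intersection S1 f1 h1 = 1.
  rewrite /intersection (bigD1 s0) //= big1 => [|i /negPf ii].
    by rewrite !f1P !h1P !eqxx.
  have xi0 : (genx _ i == genx _ s0 :> gen (genus S1) (nbd S1)) = false := ii.
  by rewrite !f1P !h1P xi0 /= !mul0r.
have I0 : intersection S f h = 1.
  rewrite -I1 -(funext fi1) -(funext hi1).
  by apply: (sub_orientation hsub1) => // j; case: (no_bd j).
pose c0 := product_cocycle R f h.
have hc0 : two_cocycle c0 := product_cocycleP R hf hh.
have [psi hpsi] := bordered_trivialization (gens_presents S1)
  (product_cocycleP R hf1 hh1) b1.
(* The relator value is the intersection number 1 and also minus [psi] at the boundary; as [f1] and
   [h1] vanish there, [psi] ignores conjugation and changes sign under inversion. *)
have psic1 : psi c1 = - (-1) ^+ e.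
  have psiz : psi (bd k0) = -1.
    have := relator_value_trivialized (gens_presents S1) (product_cocycleP R hf1 hh1) hpsi.
    rewrite relator_value_product // I1 (bigD1 k0) //= big1 ?addr0.
      by rewrite mulr1z => /eqP; rewrite eq_sym eqr_oppLR => /eqP.
    by move=> k; rewrite (kk0 k) eqxx.
  have := trivializes_product_conj u hf1 hh1 hpsi (f1z k0) (h1z k0).
  rewrite -uE psiz /orient; case: (e) => //.
  rewrite (trivializesV _ (product_cocycleP R hf1 hh1) hpsi) /product_cocycle.
  by rewrite (hom_c1 _ hf1 f1z) mul0r subr0 opprK => /eqP; rewrite eqr_opp => /eqP.
pose c x y := cup_cocycle a b x y - lam * c0 x y.
have hc : two_cocycle c := two_cocycleB lam (cup_cocycleP a b) hc0.
have hc1 : trivializes (fun x y => c (i1 x) (i1 y)) (fun x => phi1 x - lam * psi x).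
  move=> x y; rewrite /c /c0 /product_cocycle.
  have /= -> := fi1 x; have /= -> := hi1 y.
  exact: trivializesB hphi1 hpsi x y.
(* The correction vanishes over [S2] because [f] does. *)
have hc2 : trivializes (fun x y => c (i2 x) (i2 y)) phi2.
  by move=> x y; rewrite hphi2 /c /c0 /product_cocycle fi2 mul0r mulr0 subr0.
(* By the values of [lam] and [psi c1], the correction [- lam * psi c1] is exactly the mismatch
   [phi2 c2 - phi1 c1]. *)
have [|phi [hphi _ _]] := amalgam_trivialization ham hc hc1 hc2.
  rewrite psic1 lamE mulrN opprK mulrAC -expr2 sqrr_sign mul1r.
  by rewrite addrC subrK.
(* Without boundary the relator value of [c] is 0, so that of the cup product is [lam] times 1. *)
have := relator_value_trivialized (gens_presents S) hc hphi.
rewrite word_valueB relator_value_product // ?I0; try by move=> j; case: (no_bd j).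
rewrite big1 ?oppr0 => [|j _]; last by case: (no_bd j).
move/eqP; rewrite mulr1 subr_eq0 => /eqP <-.
rewrite /omega_Z1 /cup cup_word_value big1 ?subr0 // => j _; case: (no_bd j).
Qed.

End Additivity.

Theorem theorem4p3p1 (R : realType) (n : nat)
    (G G1 G2 : groupType)
    (S : surface G) (S1 : surface G1) (S2 : surface G2)
    (i1 : {multiplicative G1 -> G}) (i2 : {multiplicative G2 -> G})
    (xi : G) (e : bool)
    (t1 : 'I_(nbd S1) -> option 'I_(nbd S))
    (t2 : 'I_(nbd S2) -> option 'I_(nbd S))
    (hsep : separates i1 i2 xi e t1 t2)
    (B : 'I_(nbd S) -> set (PSL R n)) (hB : forall j, conj_class (B j))
    (C : set (PSL R n)) (hC : conj_class C)
    (rho : rep R n G)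
    (hrho : Xbar_bd_xi B xi C (rep_class rho))
    (hrho1 : Xbar_bd (induced_frame B C e t1) (rep_class (res_rep rho i1)))
    (hrho2 : Xbar_bd (induced_frame B C (~~ e) t2) (rep_class (res_rep rho i2)))
    (a b : H1 rho)
    (ha : H1par (bd_xi_family S xi) a) (hb : H1par (bd_xi_family S xi) b) :
  omegaK S a b =
    omegaK S1 (res_H1 i1 a) (res_H1 i1 b) + omegaK S2 (res_H1 i2 a) (res_H1 i2 b).
Proof.
have parP (d : H1 rho) : H1par (bd_xi_family S xi) d ->
    (forall j : 'I_(nbd S), cobd_at (repr d) (bd j)) /\ cobd_at (repr d) xi.
  have cyc_id (z : G) : cyc z z by exists 1%N; left; rewrite expg1.
  move=> /repr_H1par hd; split=> [j|].
    by have [|X hX] := hd (cyc (bd j)); [right; exists j | exists X; apply: hX].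
  by have [|X hX] := hd (cyc xi); [left | exists X; apply: hX].
have [[abd axi] [bbd bxi]] := (parP a ha, parP b hb).
have [hsub1 hsub2] := (sep_sub1 hsep, sep_sub2 hsep).
have par1 (k : 'I_(nbd S1)) : cobd_at (res_Z1 i1 (repr a)) (bd k) /\
    cobd_at (res_Z1 i1 (repr b)) (bd k).
  by split; apply: (cobd_at_subsurface hsub1).
have par2 (k : 'I_(nbd S2)) : cobd_at (res_Z1 i2 (repr a)) (bd k) /\
    cobd_at (res_Z1 i2 (repr b)) (bd k).
  by split; apply: (cobd_at_subsurface hsub2).
(* On [S] the pairing is by definition computed at [repr a] and [repr b]; only the pieces need a
   change of representatives. *)
rewrite /res_H1 (omegaK_pi (subsurface_bordered hsub1) par1).
rewrite (omegaK_pi (subsurface_bordered hsub2) par2).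
have [S0|S0] := posnP (nbd S).
  exact: (omega_additive_closed hsep).
exact: (omega_additive_bordered hsep).
Qed.
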